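(* Let $v>0$ and let $\psi:\mathbb{R}\to[0,1]$ be a continuous monotonically decreasing function with $\lim_{x\to-\infty}\psi(x)=1$ and $\lim_{x\to\infty}\psi(x)=0$. Let $u(x,t)=\psi(x-vt)$, $x\in\mathbb{R}$, $t\ge 0$, be the traveling wave with constant speed $v$ and profile $\psi$, with the two-sided estimate $$u_\varepsilon^-(x,t)\le u(x,t)\le u_\varepsilon^+(x,t)\qquad\text{for all }x\in\mathbb{R},\ t\ge 0,\ \varepsilon>0,$$ where $u_\varepsilon^{\pm}$ are the upper and lower waves defined in the context. Let $S$ be a driftless subordinator with Lévy measure $\sigma$ satisfying $\sigma((0,\infty))=\infty$, let $k(t)=\sigma((t,\infty))$, let $\mathcal{K}$ be the Laplace transform of $k$, and let $G_t(\tau)$ be the probability density of $E(t)$, where $E$ is the inverse process of $S$. Assume that, for some $0<\alpha<1$, $$\mathcal{K}(\lambda)\sim\lambda^{\alpha-1}\qquad\text{as }\lambda\to 0^+ .$$ Let $u^E(x,t)=\int_0^\infty u(x,\tau)G_t(\tau)\,\mathrm{d}\tau$ be the subordination of $u$ by $G_t$, and let $M_t(u^E(x,\cdot))=\frac1t\int_0^t u^E(x,s)\,\mathrm{d}s$ be its Cesàro mean. For $\beta\in(0,1)$ and $t>0$ let $x_\beta(t)\in\mathbb{R}$ be the propagation of the front of level $\beta$ of the Cesàro mean, i.e. the solution of $M_t(u^E(x_\beta(t),\cdot))=\beta$. Then for every $\beta\in(0,1)$ there are constants $C_-,C_+>0$ such that $$C_-t^\alpha\le x_\beta(t)\le C_+t^\alpha\qquad\text{for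 all sufficiently large }t,$$ and moreover there is a constant $C>0$ such that $x_\beta(t)\sim Ct^\alpha$ as $t\to\infty$.
   Context: Asymptotic equivalence: $f\sim g$ means that $f/g\to 1$ in the indicated limit. Subordinator: $S=\{S(t),t\ge0\}$ is a process starting from $0$ with stationary and independent non-negative increments and no drift, with $\mathbb{E}(e^{-\lambda S(t)})=e^{-t\Phi(\lambda)}$ for $\lambda\ge0$, where $\Phi(\lambda)=\int_{(0,\infty)}(1-e^{-\lambda\tau})\,\mathrm{d}\sigma(\tau)$ and the Lévy measure $\sigma$ satisfies $\int_{(0,\infty)}(1\wedge\tau)\,\mathrm{d}\sigma(\tau)<\infty$ and $\sigma((0,\infty))=\infty$. Put $k(t)=\sigma((t,\infty))$ for $t>0$ and $\mathcal{K}(\lambda)=\int_0^\infty e^{-\lambda t}k(t)\,\mathrm{d}t$; then $\Phi(\lambda)=\lambda\mathcal{K}(\lambda)$ for $\lambda>0$. The inverse process is $E(t)=\inf\{s\ge0: S(s)\ge t\}$, and $G_t(\tau)$, $\tau\ge0$, is the density of the law of $E(t)$, so that $P(E(t)\le\tau)=P(S(\tau)\ge t)$. Upper and lower waves: for each $\varepsilon>0$ choose $x_\varepsilon^-,x_\varepsilon^+\in\mathbb{R}$ such that $\psi(y)<\varepsilon$ for all $y>x_\varepsilon^+$ and $\psi(y)>1-\varepsilon$ for all $y<x_\varepsilon^-$, and set $u_\varepsilon^+(x,t)=\mathbf{1}_{(-\infty,x_\varepsilon^+]}(x-vt)+\varepsilon\,\mathbf{1}_{[x_\varepsilon^+,\infty)}(x-vt)$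 and $u_\varepsilon^-(x,t)=(1-\varepsilon)\,\mathbf{1}_{(-\infty,x_\varepsilon^-]}(x-vt)$. *)

(* Defs.v *)
From mathcomp Require Export all_boot all_order all_algebra.
From mathcomp Require Export all_classical all_reals all_analysis.
From mathcomp Require Export measurable_realfun.

Set Implicit Arguments.
Unset Strict Implicit.
Unset Printing Implicit Defensive.

Export Order.TTheory GRing.Theory Num.Theory.
Export numFieldNormedType.Exports.

Local Open Scope classical_set_scope.
Local Open Scope ring_scope.

Definition asymp_equiv (R : realType) (F : set_system R) (f g : R -> R) : Prop :=
  f x / g x @[x --> F] --> (1 : R).

(* A measure on (0, oo) is represented by a measure on R of which only the
   values on subsets of ]0, +oo[ are ever used. *)
Record infinite_levy_measure (R : realType)
    (sigma : {measure set (measurableTypeR R) -> \bar R}) : Prop := {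
  levy_integrable :
    (\int[sigma]_(tau in `]0%R, +oo[%classic) (Num.min 1 tau)%:E < +oo)%E;
  levy_infinite : (sigma `]0%R, +oo[%classic = +oo)%E }.

Definition levy_tail (R : realType)
    (sigma : {measure set (measurableTypeR R) -> \bar R}) (t : R) : \bar R :=
  sigma `]t, +oo[%classic.

Definition levy_tail_laplace (R : realType)
    (sigma : {measure set (measurableTypeR R) -> \bar R}) (lambda : R) : R :=
  fine (\int[@lebesgue_measure R]_(t in `]0%R, +oo[%classic)
          ((expR (- (lambda * t)))%:E * levy_tail sigma t))%E.

Definition laplace_exponent (R : realType)
    (sigma : {measure set (measurableTypeR R) -> \bar R}) (lambda : R) : R :=
  (\int[sigma]_(tau in `]0%R, +oo[%classic) (1 - expR (- (lambda * tau))))%R.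

(* Mutual independence of the increments of S over consecutive times
   0 <= s 0 <= ... <= s n. *)
Definition independent_increments (d : measure_display) (T : measurableType d)
    (R : realType) (P : probability T R) (S : R -> {RV P >-> R}) : Prop :=
  forall (n : nat) (s : nat -> R) (B : nat -> set (measurableTypeR R)),
    0 <= s 0%N -> {homo s : i j / (i <= j)%N >-> i <= j} ->
    (forall i, measurable (B i)) ->
    (P (\bigcap_(i in [set i | (i < n)%N])
          [set w | B i (S (s i.+1) w - S (s i) w)%R])
     = \prod_(i < n) P [set w | B i (S (s i.+1) w - S (s i) w)%R])%E.

(* Non-negativity of the increments is required for almost every path and all
   pairs of times simultaneously.  The absence of drift is the absence of a
   linear term in [laplace_exponent]. *)
Record driftless_subordinator (d : measure_display) (T : measurableType d)
    (R : realType) (P : probability T R)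
    (sigma : {measure set (measurableTypeR R) -> \bar R})
    (S : R -> {RV P >-> R}) : Prop := {
  subord_start : {ae P, forall w, S 0 w = 0};
  subord_incr_ge0 :
    {ae P, forall w, forall s t : R, 0 <= s -> s <= t -> 0 <= S t w - S s w};
  subord_stationary : forall (s h : R) (B : set (measurableTypeR R)),
    0 <= s -> 0 <= h -> measurable B ->
    P [set w | B (S (s + h) w - S s w)] = P [set w | B (S h w)];
  subord_independent : independent_increments S;
  subord_laplace : forall t lambda : R, 0 <= t -> 0 <= lambda ->
    ('E_P[fun w => expR (- (lambda * S t w))]
     = (expR (- (t * laplace_exponent sigma lambda)))%:E)%E }.

(* Extended-real valued, so that the infimum of the empty set is +oo (it would
   be 0 in R). *)
Definition inverse_process (R : realType) (T : Type) (S : R -> T -> R)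
    (t : R) (w : T) : \bar R :=
  ereal_inf [set s%:E | s in [set s : R | 0 <= s /\ t <= S s w]].

(* The law of X is g(tau) dtau on [0, oo); testing against all Borel subsets of
   \bar R forces X to be finite almost surely. *)
Definition is_density_on_nonneg (d : measure_display) (T : measurableType d)
    (R : realType) (P : probability T R) (X : T -> \bar R) (g : R -> R) : Prop :=
  [/\ measurable_fun setT X,
      measurable_fun (`[0, +oo[%classic : set (measurableTypeR R)) g,
      forall tau, 0 <= tau -> 0 <= g tau &
      forall B : set (\bar R), measurable B ->
        (P (X @^-1` B)
         = \int[@lebesgue_measure R]_(tau in `[0%R, +oo[%classic `&` EFin @^-1` B)
             (g tau)%:E)%E].

Definition traveling_wave (R : realType) (v : R) (psi : R -> R) (x t : R) : R :=
  psi (x - v * t).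

(* The two indicator sets overlap at xp, where the value is 1 + eps. *)
Definition upper_wave (R : realType) (v eps xp : R) (x t : R) : R :=
  \1_(`]-oo, xp]%classic) (x - v * t) + eps * \1_(`[xp, +oo[%classic) (x - v * t).

Definition lower_wave (R : realType) (v eps xm : R) (x t : R) : R :=
  (1 - eps) * \1_(`]-oo, xm]%classic) (x - v * t).

Definition subordination (R : realType) (u G : R -> R -> R) (x t : R) : R :=
  (\int[@lebesgue_measure R]_(tau in `[0%R, +oo[%classic) (u x tau * G t tau))%R.

Definition cesaro_mean (R : realType) (f : R -> R) (t : R) : R :=
  t^-1 * (\int[@lebesgue_measure R]_(s in `[0%R, t]%classic) f s)%R.

(* Main.v *)
Require Import Defs.
From HB Require Import structures.
From mathcomp Require Import ring lra.

(* Write [ramp z = max 0 (1 - z)].  Since [E(s) > tau] forces [S(tau) < s],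
   which in turn forces [E(s) >= tau] almost surely, and since the wave is
   nearly 1 behind the front and nearly 0 ahead of it, the Cesaro mean at
   [x = v tau] is, up to epsilon,
   [t^-1 int_0^t P(S(tau) < s) ds = E ramp (S(tau) / t)].  For
   [tau = (a t)^alpha] the Laplace transform of [S(tau) / t] converges to that of
   [a] times a stable variable; as [ramp] is a uniform limit of polynomials in
   [exp (- z)], the expectation converges to some [J a] without any need to
   construct the stable law.  [J] is convex and nonincreasing from 1 to 0, so it
   crosses the level [beta] at a single [c], and [x t ~ v (c t)^alpha]. *)

Set Implicit Arguments.
Unset Strict Implicit.
Unset Printing Implicit Defensive.

Local Open Scope classical_set_scope.
Local Open Scope ring_scope.

(** * Bernstein approximation of the ramp function *)

(** Averaging over time is what makes convergence of Laplace transforms enough: at a single time one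
    would need convergence of [P(S(tau) < s)], hence continuity of the limit law at the threshold,
    while integration over [[0, t]] turns the indicator into the continuous ramp. The limit [J] is
    known only as a limit of expectations, so no formula and no strict monotonicity come with it.
    All that is used about [J] is inherited from pointwise facts on the ramp: two exponential bounds
    that control it near 0 and at infinity, and convexity in the scale, which replaces strict
    decrease. The shape of [psi] disappears because, for two distinct constants [a], the points
    [v (a t)^alpha] drift apart without bound, while the cut-offs [xm eps] and [xp eps] stay fixed.
    A measurability obstacle remains: the densities [G t] are given for each [t > 0] separately, so
    the subordinated wave need not be measurable in time and is unconstrained at time 0. Its Cesaro
    mean is therefore only squeezed between means of measurable functions. *)

Section bernstein.
Variable R : realType.
Implicit Types (f g : nat -> R) (y : R).

(** As a polynomial in [y], the expectation of [f] at the number of successes in [n] trials of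
    probability [y], conditioned on the first trial. The argument of [f] is the raw count, not
    divided by [n]. *)
Fixpoint bernstein (n : nat) f : {poly R} :=
  if n is n'.+1 then
    'X * bernstein n' (f \o succn) + (1 - 'X) * bernstein n' f
  else (f 0%N)%:P.

Lemma horner_bernsteinS n f y : (bernstein n.+1 f).[y] =
  y * (bernstein n (f \o succn)).[y] + (1 - y) * (bernstein n f).[y].
Proof. by rewrite /= !hornerE. Qed.

Lemma bernsteinD n f g y : (bernstein n (fun k => f k + g k)).[y] =
  (bernstein n f).[y] + (bernstein n g).[y].
Proof.
elim: n f g => [|n IH] f g; first by rewrite /= !hornerE.
rewrite !horner_bernsteinS (IH (f \o succn) (g \o succn)) IH; ring.
Qed.

Lemma bernsteinZ n a f y :
  (bernstein n (fun k => a * f k)).[y] = a * (bernstein n f).[y].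
Proof.
elim: n f => [|n IH] f; first by rewrite /= !hornerE.
rewrite !horner_bernsteinS (IH (f \o succn)) IH; ring.
Qed.

Lemma bernstein_cst n a y : (bernstein n (fun=> a)).[y] = a.
Proof.
elim: n => [|n IH]; first by rewrite /= !hornerE.
rewrite horner_bernsteinS (IH : (bernstein n ((fun=> a) \o succn)).[y] = a).
ring.
Qed.

Lemma ler_bernstein n f g y : 0 <= y <= 1 -> (forall k, f k <= g k) ->
  (bernstein n f).[y] <= (bernstein n g).[y].
Proof.
move=> /andP[y0 y1]; elim: n f g => [|n IH] f g fg; first by rewrite /= !hornerE.
rewrite !horner_bernsteinS lerD//; apply: ler_wpM2l; rewrite ?subr_ge0//.
- by apply: IH => k /=.
- exact: IH.
Qed.

(* The second moment of a binomial law about [- a]; the shift [a] lets the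
   induction condition on the first trial. *)
Lemma bernstein_sqr n a y : (bernstein n (fun k => (k%:R + a) ^+ 2)).[y] =
  n%:R * (y * (1 - y)) + (n%:R * y + a) ^+ 2.
Proof.
elim: n a => [|n IH] a; first by rewrite /= !hornerE; ring.
rewrite horner_bernsteinS IH.
rewrite (_ : _ \o _ = fun k => (k%:R + (a + 1)) ^+ 2); last first.
  by apply/funext => k /=; rewrite -natr1; ring.
by rewrite IH -natr1; ring.
Qed.

(** A quadratic majorant of the Lipschitz error replaces the usual Chebyshev split. The Lipschitz
    bound is asked beyond 1 because [ler_bernstein] compares functions at every [k], so [k / n] may
    exceed 1. *)
Lemma bernstein_approx (g : R -> R) (L eps : R) : 0 < L -> 0 < eps ->
  (forall a b, 0 <= a <= b -> `|g b - g a| <= L * (b - a)) ->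
  exists p : {poly R}, forall y, 0 <= y <= 1 -> `|g y - p.[y]| <= eps.
Proof.
move=> L0 e0 gL.
pose dl := eps / (2 * L).
have dl0 : 0 < dl by rewrite divr_gt0// mulr_gt0.
have Ldl : L * dl = eps / 2 by rewrite /dl; field; rewrite gt_eqF.
clearbody dl.
pose n := (Num.truncn (2 * L / (dl * eps))).+1.
have n0 : 0 < n%:R :> R by rewrite ltr0n.
have nP : 2 * L / (dl * eps) <= n%:R by rewrite ltW// truncnS_gt.
pose f k := g (k%:R / n%:R).
exists (bernstein n f) => y /[dup] y01 /andP[y0 y1].
(* This is [L * (dl + c ^+ 2 / dl)] with [c = k / n - y], which dominates [L * |c|]. It is written
   in the form whose mean [bernstein_sqr] computes; [dl] and [n] make each of the two terms of that
   mean at most [eps / 2]. *)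
pose q k : R := L * dl + L / (dl * n%:R ^+ 2) * (k%:R + - (n%:R * y)) ^+ 2.
have fq k : `|f k - g y| <= q k.
  have -> : q k = L * (dl + (k%:R / n%:R - y) ^+ 2 / dl).
    by rewrite /q; field; rewrite !gt_eqF.
  have dP : `|k%:R / n%:R - y| <= dl + (k%:R / n%:R - y) ^+ 2 / dl.
    set c := k%:R / n%:R - y.
    rewrite -(ler_pM2r dl0) mulrDl divfK ?gt_eqF//.
    by rewrite -(real_normK (num_real c)); have := normr_ge0 c; nra.
  have kn : 0 <= k%:R / n%:R :> R by rewrite divr_ge0.
  rewrite /f; have [le|/ltW le] := leP (k%:R / n%:R) y.
  - rewrite distrC (le_trans (gL _ _ _)) ?kn// ler_pM2l//.
    by rewrite (le_trans _ dP)// distrC ler_norm.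
  - rewrite (le_trans (gL _ _ _)) ?y0// ler_pM2l//.
    by rewrite (le_trans _ dP)// ler_norm.
have qE : (bernstein n q).[y] <= eps.
  rewrite /q bernsteinD bernstein_cst bernsteinZ bernstein_sqr.
  rewrite addrN expr0n addr0 Ldl.
  have -> : L / (dl * n%:R ^+ 2) * (n%:R * (y * (1 - y))) =
            L / (dl * n%:R) * (y * (1 - y)).
    by field; rewrite !gt_eqF.
  have : L / (dl * n%:R) <= eps / 2.
    move: nP; rewrite !ler_pdivrMr ?mulr_gt0//.
    set w := n%:R; nra.
  have : 0 <= L / (dl * n%:R) by rewrite divr_ge0 ?mulr_ge0// ltW.
  set w := L / _; nra.
have eqf : (bernstein n (fun k => f k + - g y)).[y] = (bernstein n f).[y] - g y.
  by rewrite bernsteinD bernstein_cst.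
rewrite distrC ler_norml -eqf; apply/andP; split.
- rewrite lerNl -mulN1r -bernsteinZ (le_trans _ qE)// ler_bernstein// => k.
  by rewrite mulN1r (le_trans _ (fq k))// -normrN ler_norm.
- rewrite (le_trans _ qE)// ler_bernstein// => k.
  by rewrite (le_trans _ (fq k))// ler_norm.
Qed.

End bernstein.

(** * The ramp: exponential bounds, convexity, approximation *)

Definition ramp (R : realType) (z : R) : R := Num.max 0 (1 - z).

Section ramp.
Variable R : realType.
Implicit Types (a b z : R).

Lemma ramp_ge0 z : 0 <= ramp z.
Proof. by rewrite /ramp le_max lexx. Qed.

Lemma ramp_le1 z : 0 <= z -> ramp z <= 1.
Proof. by move=> z0; rewrite /ramp ge_max ler01 gerBl. Qed.

Lemma ler_ramp a b : a <= b -> ramp b <= ramp a.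
Proof.
move=> ab; rewrite /ramp ge_max !le_max lexx/=.
by rewrite lerD2l lerN2 ab orbT.
Qed.

Lemma ramp_le_expR z : ramp z <= expR (- z).
Proof. by rewrite /ramp ge_max expR_ge0 expR_ge1Dx. Qed.

(** From [expR (- z) <= 1 / (1 + z)]: for [z <= 1] one has [2 / (1 + z) <= 2 - z], and for [z > 1]
    the left side is negative. It will keep [J] close to 1 near 0. *)
Lemma ramp_ge_expR z : 0 <= z -> 2 * expR (- z) - 1 <= ramp z.
Proof.
move=> z0; have ez : expR (- z) * (1 + z) <= 1.
  by rewrite -ler_pdivlMl ?expR_gt0// expRN invrK mulr1 expR_ge1Dx.
have := expR_gt0 (- z); rewrite /ramp le_max => e0.
have [z1|z1] := leP z 1; apply/orP; [right|left]; nra.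
Qed.

(** The ramp is a maximum of two affine functions. Denominators are cleared so that the inequality
    passes linearly through integrals and limits. *)
Lemma ramp_convex a b c z : a <= b <= c ->
  (c - a) * ramp (b * z) <= (c - b) * ramp (a * z) + (b - a) * ramp (c * z).
Proof.
move=> /andP[]; rewrite -subr_ge0 -[b <= c]subr_ge0 => ab bc.
have rz (w : R) : 1 - w <= ramp w by rewrite /ramp le_max lexx orbT.
have := ler_wpM2l bc (rz (a * z)); have := ler_wpM2l ab (rz (c * z)).
have := mulr_ge0 bc (ramp_ge0 (a * z)); have := mulr_ge0 ab (ramp_ge0 (c * z)).
rewrite [ramp (b * z)]/ramp; case: (leP 0 (1 - b * z)) => _; lra.
Qed.

Lemma ramp_approx eps : 0 < eps -> exists p : {poly R},
  forall z, 0 <= z -> `|ramp z - p.[expR (- z)]| <= eps.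
Proof.
move=> e0.
(* The ramp in the variable [y = expR (- z)]. It vanishes from [z = 1] on, so the logarithm can be
   frozen below [expR (- 1)], which makes it Lipschitz with constant [expR 1]. *)
pose g (y : R) := 1 + ln (Num.max y (expR (- 1))).
have gL a b : 0 <= a <= b -> `|g b - g a| <= expR 1 * (b - a).
  move=> /andP[a0 ab]; rewrite /g.
  set A := Num.max a _; set B := Num.max b _.
  have Ae : expR (-1) <= A by rewrite /A le_max lexx orbT.
  have A0 : 0 < A by rewrite (lt_le_trans _ Ae)// expR_gt0.
  have AB : A <= B.
    by rewrite /A /B ge_max !le_max ab lexx orbT.
  have B0 := lt_le_trans A0 AB.
  have BA : B - A <= b - a.
    rewrite /A /B; case: (leP a (expR _)) => h1; case: (leP b (expR _)) => h2; lra.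
  rewrite opprD addrACA subrr add0r -ln_div ?posrE// ger0_norm; last first.
    by rewrite ln_ge0// ler_pdivlMr// mul1r.
  have lnB : ln (B / A) <= B / A - 1.
    rewrite -[leLHS](addKr 1) addrC lerD2r -[leRHS](@lnK R) ?posrE ?divr_gt0//.
    exact: expR_ge1Dx.
  rewrite (le_trans lnB)//.
  have -> : B / A - 1 = A^-1 * (B - A) by field; rewrite gt_eqF.
  apply: ler_pM; rewrite ?subr_ge0 ?invr_ge0 ?(ltW A0)//.
  by rewrite -[leRHS]invrK -expRN lef_pV2// ?posrE ?expR_gt0.
have [p pP] := bernstein_approx (expR_gt0 1) e0 gL.
exists p => z z0.
have -> : ramp z = g (expR (- z)).
  rewrite /ramp /g maxEle; case: ifPn => [h|]; rewrite maxEle ler_expR.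
    by case: ifPn => h'; rewrite expRK//; lra.
  by move=> h; case: ifPn => h'; rewrite expRK; lra.
by apply: pP; rewrite expR_ge0 -expR0 ler_expR oppr_le0.
Qed.

End ramp.

(** * Continuity theorem for Laplace transforms *)

Section expectation_of_bounded.
Context d (T : measurableType d) (R : realType) (P : probability T R).
Implicit Types (f X : T -> R).

Lemma bounded_integrable f (M : R) : measurable_fun setT f ->
  (forall w, `|f w| <= M) -> P.-integrable setT (EFin \o f).
Proof.
move=> mf fM; apply: (@measurable_bounded_integrable _ _ _ P) => //.
- by rewrite [X in (X < _)%E]probability_setT ltry.
- exists M; split; first exact: num_real.
  by move=> x Mx w _; exact: le_trans (fM w) (ltW Mx).
Qed.

Lemma Rintegral_prob_cst (a : R) : \int[P]_w a = a.
Proof. by rewrite Rintegral_cst//= probability_setT mulr1. Qed.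

Lemma measurable_ramp X : measurable_fun setT X ->
  measurable_fun setT (fun w => ramp (X w)).
Proof. by move=> mX; apply: measurable_maxr => //; exact: measurable_funB. Qed.

Lemma integrable_ramp X : measurable_fun setT X -> (forall w, 0 <= X w) ->
  P.-integrable setT (EFin \o (fun w => ramp (X w))).
Proof.
move=> mX X0; apply: (@bounded_integrable _ 1); first exact: measurable_ramp.
by move=> w; rewrite ger0_norm ?ramp_ge0 ?ramp_le1.
Qed.

Lemma integrable_expRN X : measurable_fun setT X -> (forall w, 0 <= X w) ->
  P.-integrable setT (EFin \o (fun w => expR (- X w))).
Proof.
move=> mX X0; apply: (@bounded_integrable _ 1).
- by apply: measurableT_comp => //; exact: measurable_funN.
- by move=> w; rewrite ger0_norm ?expR_ge0// -expR0 ler_expR oppr_le0.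
Qed.

End expectation_of_bounded.

Section laplace_continuity.
Context d (T : measurableType d) (R : realType) (P : probability T R).
Variables (Z : R -> T -> R) (ell : nat -> R).
Hypothesis mZ : forall t, measurable_fun setT (Z t).
Hypothesis Z_ge0 : forall t w, 0 <= Z t w.
Hypothesis cvg_laplace : forall k : nat,
  \int[P]_w expR (- (k%:R * Z t w)) @[t --> +oo] --> ell k.

Let integrable_expn t k :
  P.-integrable setT (EFin \o (fun w => expR (- Z t w) ^+ k)).
Proof.
rewrite (_ : (fun w => _) = fun w => expR (- (k%:R * Z t w))); last first.
  by apply/funext => w; rewrite -mulrN expRM_natl.
by apply: integrable_expRN => [|w]; [exact: measurable_funM|exact: mulr_ge0].
Qed.

Lemma cvg_expectation_poly (p : {poly R}) :
  (forall t, P.-integrable setT (EFin \o (fun w => p.[expR (- Z t w)]))) /\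
  cvg (\int[P]_w p.[expR (- Z t w)] @[t --> +oo]).
Proof.
(* The extra power makes the claim inductive: [poly_ind] builds [p * 'X + c], and the factor ['X] is
   absorbed by passing from [k] to [k.+1]. For constants, the power [k] integrates to the Laplace
   transform at the integer [k]. *)
suff [pi pc] : (forall k t, P.-integrable setT
    (EFin \o (fun w => p.[expR (- Z t w)] * expR (- Z t w) ^+ k))) /\
  (forall k, cvg (\int[P]_w (p.[expR (- Z t w)] * expR (- Z t w) ^+ k)
     @[t --> +oo])).
  split=> [t|]; first by under eq_fun do rewrite -[p.[_]]mulr1; exact: (pi 0%N).
  by under eq_fun do under eq_Rintegral do rewrite -[p.[_]]mulr1; exact: (pc 0%N).
elim/poly_ind: p => [|p c [pi pc]].
  split=> [k t|k].
    under eq_fun do rewrite horner0 mul0r.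
    by apply: (@bounded_integrable _ _ _ _ _ 0) => // w; rewrite normr0.
  under eq_fun do under eq_Rintegral do rewrite horner0 mul0r.
  by under eq_fun do rewrite Rintegral_prob_cst; exact: is_cvg_cst.
have E k t w : (p * 'X + c%:P).[expR (- Z t w)] * expR (- Z t w) ^+ k =
    p.[expR (- Z t w)] * expR (- Z t w) ^+ k.+1 + c * expR (- Z t w) ^+ k.
  by rewrite !hornerE exprS; ring.
have ci k t : P.-integrable setT (EFin \o (fun w => c * expR (- Z t w) ^+ k)).
  exact: (integrableZl _ c (integrable_expn t k)).
split=> [k t|k].
  by under eq_fun do rewrite E; exact: (integrableD _ (pi k.+1 t) (ci k t)).
under eq_fun do under eq_Rintegral do rewrite E.
under eq_fun do rewrite RintegralD//.
apply: is_cvgD => //.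
under eq_fun do rewrite RintegralZl//.
apply: is_cvgMr; apply/cvg_ex; exists (ell k).
under eq_fun do under eq_Rintegral do rewrite -expRM_natl mulrN.
exact: cvg_laplace.
Qed.

Lemma cvg_expectation_ramp : cvg (\int[P]_w ramp (Z t w) @[t --> +oo]).
Proof.
(* No candidate limit is at hand, so completeness is used: the limit obtained for a polynomial
   within [e / 3] of the ramp serves as the centre of a ball of radius [e]. *)
apply: cauchy_cvg; apply: cauchy_exP => e e0.
have [p pP] := ramp_approx (divr_gt0 e0 (ltr0Sn R 2)).
have [pi pc] := cvg_expectation_poly p.
exists (lim (\int[P]_w p.[expR (- Z t w)] @[t --> +oo])).
have e3 : 0 < e / 3 by rewrite divr_gt0.
suff : \forall t \near +oo, `|lim (\int[P]_w p.[expR (- Z t w)] @[t --> +oo]) -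
    \int[P]_w ramp (Z t w)| < e by [].
have pe := cvgr_dist_lt _ _ pc _ e3.
near=> t.
rewrite -(subrK (\int[P]_w p.[expR (- Z t w)]) (lim _)) -addrA.
rewrite (le_lt_trans (ler_normD _ _))//.
have -> : e = e / 3 + (e / 3 + e / 3) by field.
rewrite ltrD//; first by near: t; exact: (cvgr_dist_lt _ _ pc _ e3).
rewrite distrC -RintegralB//; last exact: integrable_ramp (mZ t) (Z_ge0 t).
apply: (@le_lt_trans _ _ (e / 3)); last by lra.
have ri := integrable_ramp P (mZ t) (Z_ge0 t).
rewrite (le_trans (le_normr_Rintegral _ _))//.
  exact: (integrableB _ ri (pi t)).
rewrite -[leRHS](Rintegral_prob_cst P); apply: le_Rintegral => //.
- exact: (integrable_norm (integrableB _ ri (pi t))).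
- by apply: (@bounded_integrable _ _ _ _ _ (e / 3)) => // w; rewrite gtr0_norm ?lexx.
- by move=> w _; exact: pP.
Unshelve. all: by end_near. Qed.

End laplace_continuity.

(** * The Laplace exponent and the tail of the Levy measure *)

Section laplace_exponent.
Context (R : realType) (sigma : {measure set (measurableTypeR R) -> \bar R}).
Hypothesis sigma_levy : infinite_levy_measure sigma.

Local Notation D := (`]0%R, +oo[%classic : set (measurableTypeR R)).

(** Markov's inequality for [Num.min 1 tau], which is at least [Num.min 1 a] beyond [a]. *)
Lemma levy_tail_lty (a : R) : 0 < a -> (levy_tail sigma a < +oo)%E.
Proof.
move=> a0; have m0 : 0 < Num.min 1 a by rewrite lt_min ltr01.
suff : ((Num.min 1 a)%:E * levy_tail sigma a < +oo)%E.
  rewrite /levy_tail; case: (sigma _) (measure_ge0 sigma `]a, +oo[) => [r _ _||//].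
  - exact: ltry.
  - by move=> _; rewrite mulry gtr0_sg// mul1e.
rewrite /levy_tail (le_lt_trans _ (levy_integrable sigma_levy))//.
rewrite -integral_cst//.
have aD : `]a, +oo[ `<=` D.
  by move=> t /=; rewrite !in_itv/= !andbT; exact: lt_trans.
have mm : measurable_fun setT (fun t : measurableTypeR R => (Num.min 1 t)%:E).
  by apply/measurable_EFinP; exact: measurable_minr.
apply: (@le_trans _ _ (\int[sigma]_(t in `]a, +oo[) (Num.min 1 t)%:E)%E).
  apply: ge0_le_integral => //.
  - by move=> t _; rewrite lee_fin ltW.
  - exact: measurable_funTS.
  - move=> t /=; rewrite in_itv/= andbT => /ltW at_.
    by rewrite lee_fin le_min !ge_min lexx at_ orbT.
apply: ge0_subset_integral => //; first exact: measurable_funTS.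
by move=> t /=; rewrite in_itv/= andbT => t0; rewrite lee_fin le_min ler01 ltW.
Qed.

(** Tonelli's theorem asks for a sigma-finite measure, whereas [sigma] is unconstrained on []-oo,
    0]]. Restricted to the positive half-line it is finite beyond each [1 / (n + 1)]. *)
Lemma levy_restr_sigma_finite : exists nu :
  {sigma_finite_measure set (measurableTypeR R) -> \bar R},
  forall A, measurable A -> nu A = sigma (A `&` D).
Proof.
have mD : measurable D by [].
pose nu0 : {measure set (measurableTypeR R) -> \bar R} := mrestr sigma mD.
have sf : sigma_finite setT nu0.
  exists (fun n => `]-oo, 0%R]%classic `|` `]n.+1%:R^-1%R, +oo[%classic).
    apply/esym/seteqP; split => // t _.
    have [t0|t0] := leP t 0; first by exists 0%N => //; left; rewrite /= in_itv.
    exists (Num.truncn t^-1) => //; right; rewrite /= in_itv/= andbT.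
    by rewrite invf_plt ?posrE// truncnS_gt.
  move=> n; split; first exact: measurableU.
  rewrite /nu0/= /mrestr (_ : _ `&` _ = `]n.+1%:R^-1%R, +oo[%classic).
    exact: levy_tail_lty.
  apply/seteqP; split => t /=; rewrite !in_itv/= !andbT.
    by move=> [[|//] + ?]; lra.
  by move=> nt; split; [right|rewrite (lt_trans _ nt)].
pose H := isSigmaFinite.Build _ _ _ (nu0 : set _ -> \bar R) sf.
pose H2 := isSFinite.Build _ _ _ (nu0 : set _ -> \bar R) (sfinite_measure_sigma_finite sf).
pose nu := HB.pack_for {sigma_finite_measure set (measurableTypeR R) -> \bar R}
  (Measure.sort nu0) H H2.
by exists nu.
Qed.

Lemma integral_expR_itv (lambda b : R) : 0 < lambda -> 0 < b ->
  (\int[@lebesgue_measure R]_(t in `]0%R, b[) (expR (- (lambda * t)))%:E =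
   ((1 - expR (- (lambda * b))) / lambda)%:E)%E.
Proof.
move=> l0 b0.
pose F (t : R) := - (expR (- (lambda * t)) / lambda).
have dF (t : R) : is_derive t (1 : R) F (expR (- (lambda * t))).
  apply: is_derive_eq; rewrite /GRing.scale/=; field.
  by rewrite gt_eqF.
have cf : continuous (fun t : R => expR (- (lambda * t))).
  move=> t; apply: continuous_comp; last exact: continuous_expR.
  by apply: cvgN; apply: cvgM; [exact: cvg_cst|exact: cvg_id].
have cF : continuous F.
  by move=> t; apply: differentiable_continuous; apply/derivable1_diffP.
rewrite -(@integral_itv_bndoo R 0 b _ true false); last first.
  apply: measurable_funTS; apply/measurable_EFinP.
  exact: continuous_measurable_fun.
rewrite (@continuous_FTC2 _ (fun t => expR (- (lambda * t))) F)//.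
- by rewrite /F mulr0 oppr0 expR0 -EFinB; congr EFin; field; rewrite gt_eqF.
- exact: continuous_subspaceT.
- split.
  + by move=> t _; exact: ex_derive.
  + exact/cvg_at_right_filter/cF.
  + exact/cvg_at_left_filter/cF.
- by move=> t _; rewrite derive1E derive_val.
Qed.

(** Tonelli for [expR (- (lambda * t))] on the region [0 < t < y]: integrating [y] out first
    produces the tail, integrating [t] out first produces [(1 - expR (- (lambda * y))) / lambda]. *)
Lemma laplace_exponentE (lambda : R) : 0 < lambda ->
  laplace_exponent sigma lambda = lambda * levy_tail_laplace sigma lambda.
Proof.
move=> l0.
have [nu nuD] := levy_restr_sigma_finite.
have nuE : forall A, measurable A ->
  (nu : {measure set (measurableTypeR R) -> \bar R}) A = sigma (A `&` D) := nuD.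
pose A := [set z : R * R | 0 < z.1 /\ z.1 < z.2].
have mA : measurable (A : set (measurableTypeR R * measurableTypeR R)).
  apply: measurableI.
    rewrite -[X in measurable X]setTI.
    exact: (measurable_fun_ltr (measurable_cst _) measurable_fst).
  rewrite -[X in measurable X]setTI.
  exact: (measurable_fun_ltr measurable_fst measurable_snd).
pose f (z : measurableTypeR R * measurableTypeR R) :=
  (expR (- (lambda * z.1)) * \1_A z)%:E.
have mf : measurable_fun setT f.
  apply/measurable_EFinP; apply: measurable_funM.
    apply: measurableT_comp => //; apply: measurable_funN.
    exact: measurable_funM.
  exact: measurable_indic.
have f0 z : (0 <= f z)%E by rewrite lee_fin mulr_ge0 ?expR_ge0.
have FT := @fubini_tonelli _ _ _ _ R (@lebesgue_measure R) nu f mf f0.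
have L t : (\int[nu]_y f (t, y) =
    ((fun t => (expR (- (lambda * t)))%:E * levy_tail sigma t) \_ D) t)%E.
  rewrite /patch; case: ifPn => [|]; rewrite ?inE ?notin_setE /= in_itv/= andbT.
  - move=> t0.
    have fE y : f (t, y) =
        ((expR (- (lambda * t)))%:E * (\1_(`]t, +oo[%classic) y)%:E)%E.
      rewrite -EFinM !indicE /A; congr (_ * (nat_of_bool _)%:R)%:E.
      by apply/idP/idP; rewrite !inE /= in_itv/= andbT => // -[].
    under eq_integral do rewrite fE.
    rewrite ge0_integralZl_EFin ?expR_ge0//; last first.
      by apply/measurable_EFinP; exact: measurable_indic.
    rewrite integral_indic// setIT nuE//; congr (_ * sigma _)%E.
    apply/setIidPl => y /=; rewrite !in_itv/= !andbT; exact: lt_trans.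
  - move=> t0; apply: integral0_eq => y _; rewrite /f indicE memNset ?mulr0//.
    by move=> -[].
have K y : (\int[@lebesgue_measure R]_t f (t, y) =
    ((fun y => ((1 - expR (- (lambda * y))) / lambda)%:E) \_ D) y)%E.
  rewrite /patch; case: ifPn => [|]; rewrite ?inE ?notin_setE /= in_itv/= andbT.
  - move=> y0; rewrite -integral_expR_itv// [RHS]integral_mkcond.
    apply: eq_integral => t _; rewrite /f /patch indicE.
    case: ifPn; rewrite ?inE ?notin_setE /= in_itv/=.
      by move=> /andP[t0 ty]; rewrite mem_set ?mulr1.
    by move=> ty; rewrite memNset ?mulr0// => -[? ?]; apply: ty; exact/andP.
  - move=> y0; apply: integral0_eq => t _; rewrite /f indicE memNset ?mulr0//.
    by move=> -[/= t0 ty]; apply: y0; exact: lt_trans t0 ty.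
have {FT} : (\int[@lebesgue_measure R]_(t in D)
     ((expR (- (lambda * t)))%:E * levy_tail sigma t) =
   \int[sigma]_(y in D) ((1 - expR (- (lambda * y))) / lambda)%:E)%E.
  rewrite integral_mkcond -(eq_integral _ _ (fun t _ => L t)) FT.
  rewrite (eq_integral _ _ (fun y _ => K y)) -integral_mkcond.
  apply: eq_measure_integral => B mB BD.
  by rewrite nuE// setIidl.
rewrite /laplace_exponent /Rintegral /levy_tail_laplace => ->.
have -> : (\int[sigma]_(y in D) (1 - expR (- (lambda * y)))%:E =
    lambda%:E * \int[sigma]_(y in D) ((1 - expR (- (lambda * y))) / lambda)%:E)%E.
  rewrite -ge0_integralZl_EFin ?(ltW l0)//.
  - apply: eq_integral => y _; rewrite -EFinM; congr EFin; field.
    by rewrite gt_eqF.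
  - move=> y /=; rewrite in_itv/= andbT => y0; rewrite lee_fin divr_ge0 ?(ltW l0)//.
    by rewrite subr_ge0 -expR0 ler_expR oppr_le0 mulr_ge0// ltW.
  - apply: measurable_funTS; apply/measurable_EFinP; apply: measurable_funM => //.
    apply: measurable_funB => //; apply: measurableT_comp => //.
    by apply: measurable_funN; exact: measurable_funM.
case: (integral _ _ _) => [r //||].
- by rewrite mulry gtr0_sg// mul1e/= mulr0.
- by rewrite mulrNy gtr0_sg// mul1e/= mulr0.
Qed.

End laplace_exponent.

(** * The scaling limit of the subordinator *)

Section subordinator.
Context (R : realType) (d : measure_display) (T : measurableType d)
  (P : probability T R) (sigma : {measure set (measurableTypeR R) -> \bar R})
  (S : R -> {RV P >-> R}).
Hypothesis sigma_levy : infinite_levy_measure sigma.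
Hypothesis S_subord : driftless_subordinator sigma S.

(** [S tau] is nonnegative only almost surely; the truncation is a version that is nonnegative at
    every [w], as the bounds [ramp <= 1] and [expR (- z) <= 1] require. *)
Definition subord_pos (tau : R) (w : T) : R := Num.max 0 (S tau w).
Local Notation Sp := subord_pos.

Lemma subord_pos_ge0 tau w : 0 <= Sp tau w.
Proof. by rewrite /Sp le_max lexx. Qed.

Lemma measurable_subord_pos tau : measurable_fun setT (Sp tau).
Proof. by apply: measurable_maxr => //; exact: measurable_funPT. Qed.

Lemma subord_pos_ae tau : 0 <= tau -> {ae P, forall w, Sp tau w = S tau w}.
Proof.
move=> tau0.
apply: filterS2 (subord_start S_subord) (subord_incr_ge0 S_subord) => w S0 Sle.
rewrite /Sp; apply: max_r; have := Sle 0 tau (lexx 0) tau0.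
  by rewrite S0 subr0.
Qed.

Lemma laplace_subord_pos tau lambda : 0 <= tau -> 0 <= lambda ->
  \int[P]_w expR (- (lambda * Sp tau w)) =
  expR (- (tau * laplace_exponent sigma lambda)).
Proof.
move=> tau0 lambda0; have := subord_laplace S_subord tau0 lambda0.
rewrite unlock /Rintegral => h; rewrite -[RHS]/(fine _%:E) -h; congr fine.
apply: ge0_ae_eq_integral; first by [].
- apply/measurable_EFinP; apply: measurableT_comp => //; apply: measurable_funN.
  by apply: measurable_funM => //; exact: measurable_subord_pos.
- apply/measurable_EFinP; apply: measurableT_comp => //; apply: measurable_funN.
  by apply: measurable_funM => //; exact: measurable_funPT.
- by move=> w _ /=; rewrite lee_fin expR_ge0.
- by move=> w _ /=; rewrite lee_fin expR_ge0.
- by move: (subord_pos_ae tau0); apply: filterS => w /= -> _.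
Qed.

Variable alpha : R.
Hypothesis alpha_gt0 : 0 < alpha.
Hypothesis K_equiv : asymp_equiv (0 : R)^'+ (levy_tail_laplace sigma)
  (fun lambda => lambda `^ (alpha - 1)).

(** By [laplace_exponentE], the left side is exactly [lambda ^ alpha] times the ratio in [K_equiv]
    taken at [lambda / t]. *)
Lemma cvg_laplace_exponent (lambda : R) : 0 < lambda ->
  t `^ alpha * laplace_exponent sigma (lambda / t) @[t --> +oo]
    --> lambda `^ alpha.
Proof.
move=> l0.
have lt0 : lambda / t @[t --> +oo] --> (0 : R).
  rewrite -(mulr0 lambda); apply: cvgMr.
  by apply/gtr0_cvgV0 => //; exact: nbhs_pinfty_gt.
have lt0r : lambda / t @[t --> +oo] --> (0 : R)^'+.
  move=> A /= A0; have := lt0 _ A0; apply: filterS2 (nbhs_pinfty_gt (num_real 0)).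
  by move=> t t0; apply; rewrite divr_gt0.
rewrite -[X in _ --> X]mulr1.
apply: cvg_trans (cvgMr (cvg_comp _ _ lt0r K_equiv)).
apply: near_eq_cvg; near=> t.
have t0 : 0 < t by near: t; exact: nbhs_pinfty_gt.
have lt_gt0 : 0 < lambda / t by rewrite divr_gt0.
rewrite /= laplace_exponentE//.
have -> : lambda `^ alpha = t `^ alpha * (lambda / t) `^ alpha.
  by rewrite -powRM ?(ltW t0) ?(ltW lt_gt0)// mulrC divfK ?gt_eqF.
rewrite -(mulr_powRB1 (ltW lt_gt0) alpha_gt0).
by field; rewrite !gt_eqF ?powR_gt0.
Unshelve. all: by end_near. Qed.

(** The absolute value changes nothing near [+oo] and keeps the scaled variable nonnegative for
    every real [t], as the continuity theorem demands. *)
Lemma cvg_laplace_subord (lambda : R) : 0 <= lambda ->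
  \int[P]_w expR (- (lambda * (Sp (t `^ alpha) w / `|t|))) @[t --> +oo]
    --> expR (- lambda `^ alpha).
Proof.
rewrite le_eqVlt => /predU1P[<-|l0].
  rewrite powR0 ?gt_eqF// oppr0 expR0.
  under eq_fun do under eq_Rintegral do rewrite mul0r oppr0 expR0.
  by under eq_fun do rewrite Rintegral_prob_cst; exact: cvg_cst.
apply: (@cvg_trans _
  (expR (- (t `^ alpha * laplace_exponent sigma (lambda / t))) @[t --> +oo])).
  apply: near_eq_cvg; near=> t.
  have t0 : 0 < t by near: t; exact: nbhs_pinfty_gt.
  rewrite -laplace_subord_pos ?powR_ge0 ?divr_ge0 ?(ltW t0) ?(ltW l0)//.
  by apply: eq_Rintegral => w _; rewrite gtr0_norm// mulrA mulrAC.
apply: continuous_cvg; first exact: continuous_expR.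
by apply: cvgN; exact: cvg_laplace_exponent.
Unshelve. all: by end_near. Qed.

Let Z (a t : R) (w : T) := a * (Sp (t `^ alpha) w / `|t|).

Let Z_ge0 a t w : 0 <= a -> 0 <= Z a t w.
Proof. by move=> a0; rewrite mulr_ge0// divr_ge0// subord_pos_ge0. Qed.

Let mZ a t : measurable_fun setT (Z a t).
Proof.
apply: measurable_funM => //; apply: measurable_funM => //.
exact: measurable_subord_pos.
Qed.

(** The scale [a] multiplies one random variable common to all [a], instead of entering through the
    time [(a t)^alpha]; monotonicity and convexity in [a] then hold for each [w]. Replacing [t] by
    [a * t] recovers the other form. *)
Definition front_profile (a : R) : R :=
  lim (\int[P]_w ramp (a * (Sp (t `^ alpha) w / `|t|)) @[t --> +oo]).
Local Notation J := front_profile.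

Let cvg_front_profile a : 0 <= a ->
  \int[P]_w ramp (Z a t w) @[t --> +oo] --> J a.
Proof.
move=> a0.
apply: (@cvg_expectation_ramp _ _ _ P (Z a) (fun k => expR (- (k%:R * a) `^ alpha))).
- by move=> t; exact: mZ.
- by move=> t w; exact: Z_ge0.
- move=> k; under eq_fun do under eq_Rintegral do rewrite mulrA.
  by apply: cvg_laplace_subord; rewrite mulr_ge0.
Qed.

Lemma cvg_scaled_front_profile a : 0 < a ->
  \int[P]_w ramp (Sp ((a * t) `^ alpha) w / t) @[t --> +oo] --> J a.
Proof.
move=> a0.
have aty : a * t @[t --> +oo] --> +oo by exact: gt0_cvgMry.
have := cvg_comp _ _ aty (cvg_front_profile (ltW a0)).
apply: cvg_trans; apply: near_eq_cvg; near=> t.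
have t0 : 0 < t by near: t; exact: nbhs_pinfty_gt.
rewrite /=; apply: eq_Rintegral => w _; rewrite /Z gtr0_norm ?mulr_gt0//.
by congr ramp; field; rewrite !gt_eqF.
Unshelve. all: by end_near. Qed.

Lemma front_profile_le_expR a : 0 <= a -> J a <= expR (- a `^ alpha).
Proof.
move=> a0; have cJ := cvg_front_profile a0.
rewrite -(cvg_lim _ (cvg_laplace_subord a0))//.
apply: ler_lim; [exact: cvgP cJ|exact: cvgP (cvg_laplace_subord a0)|].
near=> t; apply: le_Rintegral => //.
- by apply: integrable_ramp => [|w]; [exact: mZ|exact: Z_ge0].
- by apply: integrable_expRN => [|w]; [exact: mZ|exact: Z_ge0].
- by move=> w _; exact: ramp_le_expR.
Unshelve. all: by end_near. Qed.

Lemma front_profile_ge_expR a : 0 <= a -> 2 * expR (- a `^ alpha) - 1 <= J a.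
Proof.
move=> a0; have cJ := cvg_front_profile a0.
have cL : 2 * \int[P]_w expR (- (a * (Sp (t `^ alpha) w / `|t|))) - 1
    @[t --> +oo] --> 2 * expR (- a `^ alpha) - 1.
  apply: cvgB; last exact: cvg_cst.
  by apply: cvgMr; exact: cvg_laplace_subord.
rewrite -(cvg_lim _ cL)//.
apply: ler_lim; [exact: cvgP cL|exact: cvgP cJ|].
near=> t.
have ie : P.-integrable setT (EFin \o (fun w => expR (- Z a t w))).
  by apply: integrable_expRN => [|w]; [exact: mZ|exact: Z_ge0].
rewrite -RintegralZl//.
have i2e : P.-integrable setT (EFin \o (fun w => 2 * expR (- Z a t w))).
  exact: (integrableZl _ 2 ie).
have i1 : P.-integrable setT (EFin \o (fun=> 1 : R)).
  by apply: (@bounded_integrable _ _ _ _ _ 1) => // w; rewrite normr1.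
rewrite -[X in _ - X](Rintegral_prob_cst P) -RintegralB//.
apply: le_Rintegral => //.
- exact: (integrableB _ i2e i1).
- by apply: integrable_ramp => [|w]; [exact: mZ|exact: Z_ge0].
- by move=> w _; apply: ramp_ge_expR; exact: Z_ge0.
Unshelve. all: by end_near. Qed.

Lemma front_profile_nonincreasing a b : 0 <= a -> a <= b -> J b <= J a.
Proof.
move=> a0 ab; have b0 := le_trans a0 ab.
apply: ler_lim; [exact: cvgP (cvg_front_profile b0)|
  exact: cvgP (cvg_front_profile a0)|].
near=> t; apply: le_Rintegral => //.
- by apply: integrable_ramp => [|w]; [exact: mZ|exact: Z_ge0].
- by apply: integrable_ramp => [|w]; [exact: mZ|exact: Z_ge0].
- move=> w _; apply: ler_ramp; apply: ler_wpM2r => //.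
  by rewrite divr_ge0// subord_pos_ge0.
Unshelve. all: by end_near. Qed.

Lemma front_profile_convex a b c : 0 <= a -> a <= b <= c ->
  (c - a) * J b <= (c - b) * J a + (b - a) * J c.
Proof.
move=> a0 /[dup] abc /andP[ab bc].
have b0 := le_trans a0 ab; have c0 := le_trans b0 bc.
have cl : (c - a) * \int[P]_w ramp (Z b t w) @[t --> +oo] --> (c - a) * J b.
  by apply: cvgMr; exact: cvg_front_profile.
have cr : (c - b) * \int[P]_w ramp (Z a t w) + (b - a) * \int[P]_w ramp (Z c t w)
    @[t --> +oo] --> (c - b) * J a + (b - a) * J c.
  by apply: cvgD; apply: cvgMr; exact: cvg_front_profile.
rewrite -(cvg_lim _ cl)// -(cvg_lim _ cr)//.
apply: ler_lim; [exact: cvgP cl|exact: cvgP cr|].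
near=> t.
have ir e : 0 <= e -> P.-integrable setT (EFin \o (fun w => ramp (Z e t w))).
  by move=> e0; apply: integrable_ramp => [|w]; [exact: mZ|exact: Z_ge0].
have iz k e : 0 <= e ->
    P.-integrable setT (EFin \o (fun w => k * ramp (Z e t w))).
  by move=> e0; exact: (integrableZl _ k (ir e e0)).
rewrite -!RintegralZl ?ir// -RintegralD ?iz//.
apply: le_Rintegral => //; first exact: iz.
- exact: (integrableD _ (iz _ _ a0) (iz _ _ c0)).
- by move=> w _; exact: ramp_convex.
Unshelve. all: by end_near. Qed.

End subordinator.

(** * Cesaro means of the subordinated wave *)

(* The integral of a function is a difference of suprema over simple functions,
   hence monotone even on functions that are not measurable. *)
Lemma le_integral_nonmeasurable d (T : measurableType d) (R : realType)
    (mu : {measure set T -> \bar R}) (D : set T) (f g : T -> \bar R) :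
  (forall x, D x -> f x <= g x)%E ->
  (\int[mu]_(x in D) f x <= \int[mu]_(x in D) g x)%E.
Proof.
move=> fg; rewrite integralE [leRHS]integralE.
have mono (u v : T -> \bar R) : (forall x, D x -> 0 <= u x)%E ->
    (forall x, D x -> 0 <= v x)%E -> (forall x, D x -> u x <= v x)%E ->
    (\int[mu]_(x in D) u x <= \int[mu]_(x in D) v x)%E.
  move=> u0 v0 uv; rewrite !ge0_integralE//.
  apply: le_ereal_sup => _ [h /= hu <-]; exists h => //= x.
  by rewrite (le_trans (hu x))// lee_restrict.
apply: leeB; apply: mono => x Dx.
- exact: funepos_ge0.
- exact: funepos_ge0.
- by rewrite !funeposE ge_max !le_max lexx fg// orbT.
- exact: funeneg_ge0.
- exact: funeneg_ge0.
- by rewrite !funenegE ge_max !le_max lexx leeN2 fg// orbT.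
Qed.

Lemma le_probability_ae d (T : measurableType d) (R : realType)
    (P : probability T R) (A B : set T) : measurable A -> measurable B ->
  {ae P, forall w, A w -> B w} -> (P A <= P B)%E.
Proof.
move=> mA mB [N [mN PN AB]].
rewrite (@le_trans _ _ (P (B `|` N)))//.
  rewrite le_measure ?inE//; first exact: measurableU.
  move=> w Aw; have [Bw|nBw] := pselect (B w); [by left|right].
  by apply: AB => /= ABw; exact: nBw (ABw Aw).
rewrite (le_trans (measureU2 P mB mN))//.
by rewrite [X in (_ + X)%E]PN adde0.
Qed.

(** * Time integral of a distribution function *)

Section ramp_tonelli.
Context d (T : measurableType d) (R : realType) (P : probability T R).
Variable X : T -> R.
Hypothesis mX : measurable_fun setT X.
Hypothesis X_ge0 : forall w, 0 <= X w.

Let f (z : measurableTypeR R * T) : \bar R :=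
  (\1_[set z : measurableTypeR R * T | X z.2 < z.1] z)%:E.

Let mf : measurable_fun setT f.
Proof.
apply/measurable_EFinP; apply: measurable_indic.
rewrite -[X in measurable X]setTI.
apply: (measurable_fun_ltr _ measurable_fst) => //.
exact: measurableT_comp mX measurable_snd.
Qed.

Let cdfE s : (P [set w | (X w < s)%R] = \int[P]_w f (s, w))%E.
Proof.
rewrite /f -(setIT [set w | X w < s]) -integral_indic//.
by rewrite -[X in measurable X]setTI; exact: measurable_fun_ltr.
Qed.

Lemma measurable_cdf_lt :
  measurable_fun setT (fun s : measurableTypeR R => P [set w | X w < s]).
Proof.
under eq_fun do rewrite cdfE.
apply: (measurable_fun_fubini_tonelli_F f mf) => z.
by rewrite lee_fin.
Qed.

(** By Tonelli: for fixed [w], the times of [[0, t]] exceeding [X w] form []X w, t]], of length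
    [t * ramp (X w / t)]. *)
Lemma integral_cdf_lt (t : R) : 0 < t ->
  (\int[@lebesgue_measure R]_(s in `[0%R, t]) P [set w | (X w < s)%R] =
   (t * \int[P]_w ramp (X w / t))%:E)%E.
Proof.
move=> t0.
pose A := [set z : measurableTypeR R * T | X z.2 < z.1 /\ z.1 \in `[0, t]].
have mA : measurable A.
  apply: measurableI.
    rewrite -[X in measurable X]setTI.
    apply: (measurable_fun_ltr _ measurable_fst) => //.
    exact: measurableT_comp mX measurable_snd.
  rewrite [X in measurable X](_ : _ = `[0, t]%classic `*` setT); last first.
    by apply/seteqP; split => -[s w] //= -[].
  exact: measurableX.
pose g (z : measurableTypeR R * T) : \bar R := (\1_A z)%:E.
have mg : measurable_fun setT g.
  by apply/measurable_EFinP; exact: measurable_indic.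
have g0 z : (0 <= g z)%E by rewrite lee_fin.
have FT := @fubini_tonelli _ _ _ _ R (@lebesgue_measure R) P g mg g0.
have L s : (\int[P]_w g (s, w) =
    ((fun s => P [set w | (X w < s)%R]) \_ `[0%R, t]%classic) s)%E.
  rewrite /patch; case: ifPn => [|]; rewrite ?inE ?notin_setE /= => st.
    rewrite cdfE; apply: eq_integral => w _; rewrite /g /f !indicE.
    congr (nat_of_bool _)%:R%:E; apply/idP/idP; rewrite !inE //=; by case.
  by apply: integral0_eq => w _; rewrite /g indicE memNset// => -[].
have K w : (\int[@lebesgue_measure R]_s g (s, w) = (t * ramp (X w / t))%:E)%E.
  have gE s : g (s, w) = (\1_(`]X w, t]%classic) s)%:E.
    rewrite /g !indicE.
    congr (nat_of_bool _)%:R%:E; apply/idP/idP; rewrite !inE /= !in_itv/=.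
      by move=> [Xs /andP[_ st]]; apply/andP.
    move=> /andP[Xs st]; split=> //; apply/andP; split=> //.
    exact: le_trans (X_ge0 w) (ltW Xs).
  under eq_integral do rewrite gE.
  transitivity (@lebesgue_measure R `]X w, t]%classic).
    by rewrite integral_indic// setIT.
  rewrite lebesgue_measure_itv/= lte_fin.
  rewrite /ramp maxr_pMr ?(ltW t0)// mulr0 mulrBr mulr1 mulrC divfK ?gt_eqF//.
  case: ifPn => [Xt|]; first by rewrite -EFinB max_r// subr_ge0 ltW.
  by rewrite -leNgt => tX; rewrite max_l// subr_le0.
rewrite integral_mkcond -(eq_integral _ _ (fun s _ => L s)) FT.
have ir : P.-integrable setT (EFin \o (fun w => ramp (X w / t))).
  by apply: integrable_ramp => [|w]; [exact: measurable_funM|exact/divr_ge0/ltW].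
rewrite (eq_integral _ _ (fun w _ => K w)) -RintegralZl//.
rewrite /Rintegral fineK//; apply: integrable_fin_num => //.
exact: (integrableZl _ t ir).
Qed.

End ramp_tonelli.

Lemma cesaro_mean_bounds (R : realType) (f l h : R -> R) (t : R) : 0 < t ->
  (@lebesgue_measure R).-integrable `[0, t] (EFin \o l) ->
  (@lebesgue_measure R).-integrable `[0, t] (EFin \o h) ->
  (forall s, 0 < s -> l s <= f s <= h s) ->
  cesaro_mean l t <= cesaro_mean f t <= cesaro_mean h t.
Proof.
move=> t0 il ih lfh; rewrite /cesaro_mean !ler_pM2l ?invr_gt0//.
(* The comparison is assumed for [0 < s] only, so the bounds are given the value [f 0] at 0, which
   leaves their integrals unchanged. *)
pose patch0 (g : R -> R) s := if s == 0 then f 0 else g s.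
have patchE g : (@lebesgue_measure R).-integrable `[0, t] (EFin \o g) ->
    (\int[@lebesgue_measure R]_(s in `[0%R, t]) (patch0 g s)%:E =
     \int[@lebesgue_measure R]_(s in `[0%R, t]) (g s)%:E)%E.
  move=> ig.
  have mg : measurable_fun `]0, t] (EFin \o g).
    apply: measurable_funS (measurable_int _ ig) => //.
    exact: subset_itv_oc_cc.
  have gp : {in `]0, t]%classic, EFin \o g =1 EFin \o patch0 g}.
    move=> s; rewrite inE /= in_itv/= /patch0 => /andP[s0 _].
    by rewrite gt_eqF.
  rewrite -integral_itv_obnd_cbnd; last exact: eq_measurable_fun mg.
  rewrite -[RHS]integral_itv_obnd_cbnd//.
  by apply: eq_integral => s st; exact: esym (gp s st).
have fp g : patch0 g 0 = f 0 by rewrite /patch0 eqxx.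
have lf : (\int[@lebesgue_measure R]_(s in `[0%R, t]) (l s)%:E <=
    \int[@lebesgue_measure R]_(s in `[0%R, t]) (f s)%:E)%E.
  rewrite -(patchE l)//; apply: le_integral_nonmeasurable => s /=.
  rewrite in_itv/= le_eqVlt => /andP[/predU1P[<-|s0] _]; first by rewrite fp.
  by rewrite /patch0 gt_eqF// lee_fin; case/andP: (lfh _ s0).
have fh : (\int[@lebesgue_measure R]_(s in `[0%R, t]) (f s)%:E <=
    \int[@lebesgue_measure R]_(s in `[0%R, t]) (h s)%:E)%E.
  rewrite -(patchE h)//; apply: le_integral_nonmeasurable => s /=.
  rewrite in_itv/= le_eqVlt => /andP[/predU1P[<-|s0] _]; first by rewrite fp.
  by rewrite /patch0 gt_eqF// lee_fin; case/andP: (lfh _ s0).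
have mI : measurable (`[0%R, t]%classic : set (measurableTypeR R)) by [].
have lfin := integrable_fin_num mI il; have hfin := integrable_fin_num mI ih.
(* Both bounds are needed for either inequality: [fine] is monotone only between finite values, and
   [f] itself is not known to be integrable. *)
have ffin : (\int[@lebesgue_measure R]_(s in `[0%R, t]) (f s)%:E)%E \is a fin_num.
  rewrite fin_numElt (lt_le_trans _ lf) ?(le_lt_trans fh)//.
  - by rewrite ltey_eq hfin.
  - by rewrite ltNye_eq lfin.
by rewrite !fine_le.
Qed.

(** * Integrals against the density of an extended-real variable *)

Section density.
Context d (T : measurableType d) (R : realType) (P : probability T R)
  (X : T -> \bar R) (g : R -> R).
Hypothesis Xg : is_density_on_nonneg P X g.

Local Notation mu := (@lebesgue_measure R).
Local Notation Rp := (`[0%R, +oo[%classic : set (measurableTypeR R)).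

Let g_ge0 r : Rp r -> 0 <= g r.
Proof. by rewrite /= in_itv/= andbT; case: Xg => _ _ + _; apply. Qed.

Let mg : measurable_fun Rp g. Proof. by case: Xg. Qed.

Lemma measurable_EFin_preimage (B : set (\bar R)) :
  measurable B -> measurable (EFin @^-1` B : set (measurableTypeR R)).
Proof. by move=> mB; rewrite -[X in measurable X]setTI; exact: EFin_measurable. Qed.

Lemma integral_indic_density (B : set (\bar R)) : measurable B ->
  (\int[mu]_(r in Rp) (\1_(EFin @^-1` B) r * g r)%:E = P (X @^-1` B))%E.
Proof.
move=> mB; case: Xg => _ _ _ ->//; rewrite integral_mkcondr.
apply: eq_integral => r _; rewrite /patch indicE.
by case: ifPn => rB; rewrite ?mul1r ?mul0r.
Qed.

(** Testing the density on all of [\bar R] shows that no mass escapes to infinity. This is what lets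
    a constant bound on [phi] integrate to itself. *)
Lemma integral_density : (\int[mu]_(r in Rp) (g r)%:E = 1)%E.
Proof.
have := integral_indic_density measurableT.
rewrite !preimage_setT probability_setT => <-.
by apply: eq_integral => r _; rewrite indicT mul1r.
Qed.

Variable phi : R -> R.
Hypothesis mphi : measurable_fun setT phi.
Hypothesis phi_ge0 : forall r, 0 <= phi r.
Hypothesis phi_le1 : forall r, phi r <= 1.

Let mphig : measurable_fun Rp (fun r => (phi r * g r)%:E).
Proof.
apply/measurable_EFinP; apply: measurable_funM => //.
exact: measurable_funTS.
Qed.

Lemma integral_phi_fin_num :
  (\int[mu]_(r in Rp) (phi r * g r)%:E)%E \is a fin_num.
Proof.
rewrite ge0_fin_numE; last first.
  by apply: integral_ge0 => r r0; rewrite lee_fin mulr_ge0 ?g_ge0.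
rewrite (@le_lt_trans _ _ 1%E) ?ltry// -integral_density.
apply: ge0_le_integral => //.
- by move=> r r0; rewrite lee_fin mulr_ge0 ?g_ge0.
- exact/measurable_EFinP.
- by move=> r r0; rewrite lee_fin ler_piMl ?g_ge0.
Qed.

Lemma Rintegral_density_le (eps : R) (B : set (\bar R)) : measurable B ->
  0 <= eps -> (forall r, phi r <= eps + \1_(EFin @^-1` B) r) ->
  \int[mu]_(r in Rp) (phi r * g r) <= eps + fine (P (X @^-1` B)).
Proof.
move=> mB e0 phiB; rewrite -lee_fin /Rintegral fineK ?integral_phi_fin_num//.
have mX : measurable_fun setT X by case: Xg.
rewrite EFinD fineK; last first.
  by apply: fin_num_measure; rewrite -[X in measurable X]setTI; exact: mX.
rewrite -integral_indic_density// -[eps%:E]mule1 -integral_density.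
have mgE : measurable_fun Rp (EFin \o g) by exact/measurable_EFinP.
have mi : measurable_fun Rp (fun r => (\1_(EFin @^-1` B) r * g r)%:E).
  apply/measurable_EFinP; apply: measurable_funM => //.
  by apply: measurable_funTS; apply: measurable_indic;
     exact: measurable_EFin_preimage.
rewrite -ge0_integralZl_EFin// -ge0_integralD//=.
- apply: ge0_le_integral => //=.
  + by move=> r r0; rewrite lee_fin mulr_ge0 ?g_ge0.
  + by apply: emeasurable_funD => //; exact: measurable_funeM.
  + move=> r r0; rewrite -EFinM -EFinD lee_fin -mulrDl.
    by rewrite ler_wpM2r ?g_ge0.
- by move=> r r0; rewrite -EFinM lee_fin mulr_ge0 ?g_ge0.
- exact: measurable_funeM.
- by move=> r r0; rewrite lee_fin mulr_ge0 ?g_ge0.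
Qed.

Lemma Rintegral_density_ge (c : R) (B : set (\bar R)) : measurable B ->
  0 <= c -> (forall r, c * \1_(EFin @^-1` B) r <= phi r) ->
  c * fine (P (X @^-1` B)) <= \int[mu]_(r in Rp) (phi r * g r).
Proof.
move=> mB c0 phiB; rewrite -lee_fin /Rintegral fineK ?integral_phi_fin_num//.
have mX : measurable_fun setT X by case: Xg.
rewrite EFinM fineK; last first.
  by apply: fin_num_measure; rewrite -[X in measurable X]setTI; exact: mX.
rewrite -integral_indic_density//.
have mi : measurable_fun Rp (fun r => (\1_(EFin @^-1` B) r * g r)%:E).
  apply/measurable_EFinP; apply: measurable_funM => //.
  by apply: measurable_funTS; apply: measurable_indic;
     exact: measurable_EFin_preimage.
rewrite -ge0_integralZl_EFin//; last first.
  by move=> r r0; rewrite lee_fin mulr_ge0 ?g_ge0.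
apply: ge0_le_integral => //.
- by move=> r r0; rewrite -EFinM lee_fin !mulr_ge0 ?g_ge0.
- exact: measurable_funeM.
- by move=> r r0; rewrite -EFinM lee_fin mulrA ler_wpM2r ?g_ge0.
Qed.

End density.

(** * From the inverse process to the ramp *)

Section inverse_subordinator.
Context (R : realType) (d : measure_display) (T : measurableType d)
  (P : probability T R) (sigma : {measure set (measurableTypeR R) -> \bar R})
  (S : R -> {RV P >-> R}).
Hypothesis S_subord : driftless_subordinator sigma S.

Local Notation E := (inverse_process S).
Local Notation Sp := (subord_pos S).

Lemma lt_inverse_process tau s w : 0 <= tau ->
  (tau%:E < E s w)%E -> S tau w < s.
Proof.
move=> tau0; rewrite !ltNge; apply: contra => sS.
by apply: ereal_inf_lbound; exists tau.
Qed.

(** Almost surely a level not reached at [tau] was not reached earlier either. Only a weak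
    inequality results, hence the closed interval from [tau] in [subordination_ge] against the open
    one in [subordination_le]. *)
Lemma inverse_process_ge_ae tau s : 0 <= tau ->
  {ae P, forall w, S tau w < s -> (tau%:E <= E s w)%E}.
Proof.
move=> tau0; apply: filterS (subord_incr_ge0 S_subord) => w Sle Ss.
apply: le_ereal_inf_tmp => _ [r [r0 sSr] <-]; rewrite lee_fin leNgt.
apply/negP => rtau; have := Sle r tau r0 (ltW rtau).
by rewrite subr_ge0 leNgt (lt_le_trans Ss).
Qed.

Lemma subord_pos_lt tau s : 0 < s ->
  [set w | Sp tau w < s] = [set w | S tau w < s].
Proof.
by move=> s0; apply/seteqP; split => w /=; rewrite /subord_pos gt_max s0.
Qed.

Let measurable_S_lt tau s : measurable [set w | S tau w < s].
Proof.
rewrite -[X in measurable X]setTI; exact: measurable_fun_ltr.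
Qed.

Variable G : R -> R -> R.
Hypothesis G_density : forall t, 0 < t ->
  is_density_on_nonneg P (E t) (G t).
Variables (v : R) (psi : R -> R).
Hypothesis psi_ge0 : forall y, 0 <= psi y.
Hypothesis psi_le1 : forall y, psi y <= 1.
Hypothesis psi_cont : continuous psi.

Local Notation uE := (subordination (traveling_wave v psi) G).
Let cdf tau s := fine (P [set w | Sp tau w < s]).

Let measurable_wave x : measurable_fun setT (fun r : measurableTypeR R => psi (x - v * r)).
Proof.
apply: measurableT_comp; first exact: continuous_measurable_fun.
by apply: measurable_funB => //; exact: measurable_funM.
Qed.

(** Up to the inner time [tau] the wave at [x] is at most [eps]; afterwards it is at most 1, on an
    event contained in [S(tau) < s]. *)
Lemma subordination_le x tau s eps : 0 <= tau -> 0 < s -> 0 <= eps ->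
  (forall r, r <= tau -> psi (x - v * r) <= eps) ->
  uE x s <= eps + cdf tau s.
Proof.
move=> tau0 s0 e0 psie.
have mB : measurable `]tau%:E, +oo%E]%classic by exact: emeasurable_itv.
have := Rintegral_density_le (G_density s0) (measurable_wave x)
  (fun=> psi_ge0 _) (fun=> psi_le1 _) mB e0.
have psiB r : psi (x - v * r) <= eps + \1_(EFin @^-1` `]tau%:E, +oo%E]%classic) r.
  have [rtau|taur] := leP r tau; first by rewrite (le_trans (psie r rtau))// lerDl.
  rewrite indicE mem_set; last by rewrite /= in_itv/= lte_fin taur leey.
  by rewrite (le_trans (psi_le1 _))// lerDr.
move=> /(_ psiB) /le_trans; apply; rewrite lerD2l /cdf subord_pos_lt//.
have mX : measurable_fun setT (E s) by case: (G_density s0).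
have mXB : measurable (E s @^-1` `]tau%:E, +oo%E]).
  by rewrite -[X in measurable X]setTI; exact: mX.
apply: fine_le; [exact: fin_num_measure|exact: fin_num_measure|].
apply: le_measure; rewrite ?inE// => w /=.
by rewrite in_itv/= => /andP[+ _]; exact: lt_inverse_process.
Qed.

Lemma subordination_ge x tau s c : 0 <= tau -> 0 < s -> 0 <= c ->
  (forall r, tau <= r -> c <= psi (x - v * r)) ->
  c * cdf tau s <= uE x s.
Proof.
move=> tau0 s0 c0 psic.
have mB : measurable `[tau%:E, +oo%E]%classic by exact: emeasurable_itv.
have := Rintegral_density_ge (G_density s0) (measurable_wave x)
  (fun=> psi_ge0 _) (fun=> psi_le1 _) mB c0.
have psiB r : c * \1_(EFin @^-1` `[tau%:E, +oo%E]%classic) r <= psi (x - v * r).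
  have [taur|rtau] := leP tau r.
    by rewrite (le_trans _ (psic r taur))// ler_piMr// indicE lern1 leq_b1.
  rewrite indicE memNset ?mulr0//= in_itv/= lee_fin leey andbT.
  by apply/negP; rewrite -ltNge.
move=> /(_ psiB); apply: le_trans; rewrite ler_wpM2l// /cdf subord_pos_lt//.
have mX : measurable_fun setT (E s) by case: (G_density s0).
have mXB : measurable (E s @^-1` `[tau%:E, +oo%E]).
  by rewrite -[X in measurable X]setTI; exact: mX.
apply: fine_le; [exact: fin_num_measure|exact: fin_num_measure|].
apply: le_probability_ae => //.
apply: filterS (inverse_process_ge_ae s tau0) => w h /= Ss.
by rewrite in_itv/= h// leey.
Qed.

Let measurable_cdf tau : measurable_fun setT (cdf tau).
Proof.
apply: measurableT_comp; first exact: fine_measurable.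
by apply: measurable_cdf_lt; exact: measurable_subord_pos.
Qed.

Let cdf_ge0 tau s : 0 <= cdf tau s.
Proof. exact: fine_ge0. Qed.

Let measurable_sub_lt tau s : measurable [set w | Sp tau w < s].
Proof.
rewrite -[X in measurable X]setTI; apply: measurable_fun_ltr => //.
exact: measurable_subord_pos.
Qed.

Let cdf_le1 tau s : cdf tau s <= 1.
Proof.
rewrite -[leRHS]/(fine 1%:E) fine_le ?fin_num_measure//.
exact: probability_le1.
Qed.

Let mI (t : R) : measurable (`[0%R, t]%classic : set (measurableTypeR R)).
Proof. by []. Qed.

Let lebI (t : R) : 0 < t -> @lebesgue_measure R `[0%R, t]%classic = t%:E.
Proof. by move=> t0; rewrite lebesgue_measure_itv/= lte_fin t0 -EFinB subr0. Qed.

Let integrable_itv (h : R -> R) (t M : R) : 0 < t -> measurable_fun setT h ->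
  (forall s, `|h s| <= M) ->
  (@lebesgue_measure R).-integrable `[0, t] (EFin \o h).
Proof.
move=> t0 mh hM; apply: measurable_bounded_integrable => //.
- by rewrite [X in (X < _)%E]lebI// ltry.
- exact: measurable_funTS.
- exists M; split; first exact: num_real.
  by move=> y My s _; exact: le_trans (hM s) (ltW My).
Qed.

Let integrable_cdf tau t : 0 < t ->
  (@lebesgue_measure R).-integrable `[0, t] (EFin \o cdf tau).
Proof.
move=> t0; apply: (@integrable_itv _ _ 1) => // s.
by rewrite ger0_norm.
Qed.

Let cesaro_mean_cst (a t : R) : 0 < t -> cesaro_mean (fun=> a) t = a.
Proof.
move=> t0; rewrite /cesaro_mean Rintegral_cst// [X in fine X]lebI//=.
by field; rewrite gt_eqF.
Qed.

Let integrable_cst (a t : R) : 0 < t ->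
  (@lebesgue_measure R).-integrable `[0, t] (EFin \o (fun=> a)).
Proof. by move=> t0; apply: (@integrable_itv _ _ `|a|) => // s. Qed.

Let cesaro_mean_cdf tau t : 0 < t ->
  cesaro_mean (cdf tau) t = \int[P]_w ramp (Sp tau w / t).
Proof.
move=> t0; rewrite /cesaro_mean [X in _ * X]/Rintegral.
under eq_integral do rewrite /cdf fineK ?fin_num_measure//.
rewrite integral_cdf_lt//=.
- by rewrite mulKf ?gt_eqF.
- exact: measurable_subord_pos.
- exact: subord_pos_ge0.
Qed.

Lemma cesaro_mean_le x tau t eps : 0 <= tau -> 0 < t -> 0 <= eps ->
  (forall r, r <= tau -> psi (x - v * r) <= eps) ->
  cesaro_mean (uE x) t <= eps + \int[P]_w ramp (Sp tau w / t).
Proof.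
move=> tau0 t0 e0 psie.
have ie := integrable_cst eps t0; have ic := integrable_cdf tau t0.
(* The lower bound 0, from [subordination_ge] at [c = 0], serves only to make the integral of the
   wave finite. *)
have : cesaro_mean (fun=> 0) t <= cesaro_mean (uE x) t
    <= cesaro_mean (fun s => eps + cdf tau s) t.
  apply: cesaro_mean_bounds => //; first exact: integrable_cst.
    exact: (integrableD _ ie ic).
  move=> s s0; rewrite subordination_le// andbT.
  by rewrite -[leLHS](mul0r (cdf tau s)); apply: subordination_ge.
move=> /andP[_ /le_trans]; apply.
rewrite -cesaro_mean_cdf// -[X in _ <= X + _](cesaro_mean_cst eps t0).
by rewrite /cesaro_mean RintegralD// mulrDr.
Qed.

Lemma cesaro_mean_ge x tau t c : 0 <= tau -> 0 < t -> 0 <= c ->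
  (forall r, tau <= r -> c <= psi (x - v * r)) ->
  c * \int[P]_w ramp (Sp tau w / t) <= cesaro_mean (uE x) t.
Proof.
move=> tau0 t0 c0 psic.
have ic := integrable_cdf tau t0.
(* Here the upper bound, from [subordination_le] at [eps = 1], plays that role. *)
have : cesaro_mean (fun s => c * cdf tau s) t <= cesaro_mean (uE x) t
    <= cesaro_mean (fun s => 1 + cdf tau s) t.
  apply: cesaro_mean_bounds => //.
  - exact: (integrableZl _ c ic).
  - exact: (integrableD _ (integrable_cst 1 t0) ic).
  - by move=> s s0; rewrite subordination_ge//= subordination_le.
move=> /andP[+ _]; apply: le_trans.
by rewrite -cesaro_mean_cdf// /cesaro_mean RintegralZl// mulrCA.
Qed.

End inverse_subordinator.

(** * The level of the front *)

Section level_crossing.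
Variables (R : realType) (alpha : R) (J : R -> R).
Hypothesis alpha_gt0 : 0 < alpha.
Hypothesis J_le : forall a, 0 <= a -> J a <= expR (- a `^ alpha).
Hypothesis J_ge : forall a, 0 <= a -> 2 * expR (- a `^ alpha) - 1 <= J a.
Hypothesis J_nonincreasing : forall a b, 0 <= a -> a <= b -> J b <= J a.
Hypothesis J_convex : forall a b c, 0 <= a -> a <= b <= c ->
  (c - a) * J b <= (c - b) * J a + (b - a) * J c.

Let powR_root (y : R) : 0 <= y -> (y `^ alpha^-1) `^ alpha = y.
Proof. by move=> y0; rewrite -powRrM mulVf ?gt_eqF// powRr1. Qed.

Let J_small b e : 0 < e -> exists2 a, b < a /\ 0 < a & J a < e.
Proof.
move=> e0; pose y := Num.max 1 (- ln e + 1).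
have y1 : 1 <= y by rewrite /y le_max lexx.
have y0 : 0 < y := lt_le_trans ltr01 y1.
have z0 : 0 < y `^ alpha^-1 by rewrite powR_gt0.
exists (Num.max (y `^ alpha^-1) (b + 1)).
  by rewrite !lt_max z0; split => //; apply/orP; right; rewrite ltrDl.
apply: (@le_lt_trans _ _ (J (y `^ alpha^-1))).
  by apply: J_nonincreasing; [exact: ltW|rewrite le_max lexx].
rewrite (le_lt_trans (J_le (ltW z0)))// powR_root ?(ltW y0)//.
rewrite -[ltRHS](@lnK R) ?posrE// ltr_expR.
have : - ln e + 1 <= y by rewrite /y le_max lexx orbT.
lra.
Qed.

(* A convex function that decreases to 0 cannot stay at a positive level, so
   the level set [J = beta] is at most one point. *)
Lemma level_crossing beta : 0 < beta < 1 -> exists2 c, 0 < c &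
  (forall a, 0 < a < c -> beta < J a) /\ (forall a, c < a -> J a < beta).
Proof.
move=> /andP[b0 b1].
pose A := [set a | 0 <= a /\ beta < J a].
(* The condition [2 * expR (- y) - 1 > beta] means [y < - ln ((1 + beta) / 2)]; half of this
   positive number satisfies it strictly. *)
pose y := - ln ((1 + beta) / 2) / 2.
have hb : 0 < (1 + beta) / 2 < 1 by apply/andP; split; lra.
have y0 : 0 < y by rewrite /y divr_gt0// oppr_gt0 ln_lt0.
have z0 : 0 < y `^ alpha^-1 by rewrite powR_gt0.
have Az : A (y `^ alpha^-1).
  split; first exact: ltW.
  apply: lt_le_trans (J_ge (ltW z0)); rewrite powR_root ?(ltW y0)//.
  have : (1 + beta) / 2 < expR (- y).
    rewrite -[ltLHS](@lnK R); last by rewrite posrE; case/andP: hb.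
    by rewrite ltr_expR; move: y0; rewrite /y; lra.
  lra.
have [M [_ M0] JM] := J_small 0 b0.
have ubA : ubound A M.
  move=> a [a0 Ja]; rewrite leNgt; apply/negP => Ma.
  have := J_nonincreasing (ltW M0) (ltW Ma); lra.
have supA : has_sup A by split; [exists (y `^ alpha^-1)|exists M].
have zc : y `^ alpha^-1 <= sup A by apply: ub_le_sup => //; exists M.
exists (sup A); first exact: lt_le_trans z0 zc.
split=> [a /andP[a0 ac]|a ca].
  have [a' [a'0 Ja'] aa'] := sup_gt (ex_intro _ _ Az) ac.
  exact: lt_le_trans Ja' (J_nonincreasing (ltW a0) (ltW aa')).
have c0 := lt_le_trans z0 zc.
have Jle b : sup A < b -> J b <= beta.
  move=> cb; rewrite leNgt; apply/negP => Jb.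
  have : A b by split=> //; exact: ltW (lt_trans c0 cb).
  by move=> /(ub_le_sup (ex_intro _ M ubA)); rewrite leNgt cb.
(* Strictness at [a] comes from placing it between [m], where [J m <= beta], and a far point [e],
   where [J e < beta]: the weight of [e] is positive. *)
pose m := (sup A + a) / 2.
have cm : sup A < m by rewrite /m; lra.
have ma : m < a by rewrite /m; lra.
have [e [ae e0] Je] := J_small a b0.
have := J_convex (ltW (lt_trans c0 cm)) (introT andP (conj (ltW ma) (ltW ae))).
have := Jle m cm; rewrite -[_ < beta]subr_gt0 => Jm Jc.
have : (e - m) * J a < (e - m) * beta.
  rewrite (le_lt_trans Jc)//.
  have : (e - a) * J m <= (e - a) * beta by rewrite ler_wpM2l// subr_ge0 ltW.
  have : (a - m) * J e < (a - m) * beta by rewrite ltr_pM2l// subr_gt0.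
  lra.
by rewrite ltr_pM2l ?subr_gt0// (lt_trans ma).
Qed.

End level_crossing.

(** * From bounds for every constant to the asymptotic equivalence *)

Lemma powR_cvg_pinfty (R : realType) (alpha : R) : 0 < alpha -> t `^ alpha @[t --> +oo] --> +oo.
Proof.
move=> a0; apply/cvgryPge => A; near=> t.
have t0 : 0 < t by near: t; exact: nbhs_pinfty_gt.
pose B := Num.max A 0.
rewrite (@le_trans _ _ B)// ?/B ?le_max ?lexx// -/B.
have B0 : 0 <= B by rewrite /B le_max lexx orbT.
rewrite -[leLHS](powRr1 B0) -(mulVf (lt0r_neq0 a0)) powRrM.
apply: ge0_ler_powR; rewrite ?nnegrE ?powR_ge0 ?(ltW a0) ?(ltW t0)//.
Unshelve. all: by end_near. Qed.

Lemma asymp_equiv_powR (R : realType) (alpha v c : R) (x : R -> R) :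
  0 < alpha -> 0 < v -> 0 < c ->
  (forall a, 0 < a < c -> \forall t \near +oo, v * (a * t) `^ alpha <= x t) ->
  (forall a, c < a -> \forall t \near +oo, x t <= v * (a * t) `^ alpha) ->
  asymp_equiv +oo x (fun t => v * c `^ alpha * t `^ alpha).
Proof.
move=> alpha0 v0 c0 lo hi; rewrite /asymp_equiv; apply/cvgrPdist_le => e e0.
(* The cap keeps [1 - e'] positive. Since [root] inverts the power [alpha], the choices
   [a = c * root (1 - e')] and [a = c * root (1 + e')] turn the two bounds into [1 - e'] and
   [1 + e'] times the equivalent. *)
pose e' := Num.min e (1 / 2).
have e'0 : 0 < e' by rewrite lt_min e0/=; lra.
have e'e : e' <= e by rewrite ge_min lexx.
have e'h : e' <= 1 / 2 by rewrite ge_min lexx orbT.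
pose root (y : R) := y `^ alpha^-1.
have rootK y : 0 <= y -> root y `^ alpha = y.
  by move=> y0; rewrite /root -powRrM mulVf ?gt_eqF// powRr1.
have root0 y : 0 < y -> 0 < root y by exact: powR_gt0.
have root1 : root 1 = 1 by rewrite /root powR1.
have rlt y z : 0 < y -> y < z -> root y < root z.
  move=> y0 yz; apply: gt0_ltr_powR => //; rewrite ?invr_gt0// ?nnegrE ?ltW//.
  exact: lt_trans yz.
clearbody e' root.
have lo1 : 0 < c * root (1 - e') < c.
  have h : 0 < 1 - e' by lra.
  rewrite mulr_gt0 ?root0//= -[ltRHS]mulr1 ltr_pM2l// -root1 rlt//; lra.
have hi1 : c < c * root (1 + e').
  by rewrite -[ltLHS]mulr1 ltr_pM2l// -root1 rlt//; lra.
have := lo _ lo1; have := hi _ hi1; apply: filterS3 (nbhs_pinfty_gt (num_real 0)).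
move=> t t0.
have E (y : R) : 0 < y -> v * (c * root y * t) `^ alpha = y * (v * c `^ alpha * t `^ alpha).
  move=> y0; rewrite !powRM ?mulr_ge0 ?ltW// ?root0// ?rootK ?(ltW y0)//; ring.
rewrite (E (1 - e')) ?(E (1 + e')); [|lra|lra].
set q := v * _ * _ => xh xl.
have q0 : 0 < q by rewrite /q !mulr_gt0 ?powR_gt0.
have : x t / q <= 1 + e' by rewrite ler_pdivrMr.
have : 1 - e' <= x t / q by rewrite ler_pdivlMr.
by rewrite ler_norml => h1 h2; apply/andP; split; lra.
Qed.

Theorem theorem9 (R : realType) (d : measure_display) (T : measurableType d)
    (P : probability T R)
    (v : R) (v_gt0 : 0 < v)
    (psi : R -> R)
    (psi_ge0 : forall y, 0 <= psi y) (psi_le1 : forall y, psi y <= 1)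
    (psi_cont : continuous psi)
    (psi_decr : forall y z, y <= z -> psi z <= psi y)
    (psi_ninfty : psi y @[y --> -oo] --> (1 : R))
    (psi_pinfty : psi y @[y --> +oo] --> (0 : R))
    (xm xp : R -> R)
    (xpP : forall eps, 0 < eps -> forall y, xp eps < y -> psi y < eps)
    (xmP : forall eps, 0 < eps -> forall y, y < xm eps -> 1 - eps < psi y)
    (two_sided : forall eps x t, 0 < eps -> 0 <= t ->
       lower_wave v eps (xm eps) x t <= traveling_wave v psi x t
         <= upper_wave v eps (xp eps) x t)
    (sigma : {measure set (measurableTypeR R) -> \bar R})
    (sigma_levy : infinite_levy_measure sigma)
    (S : R -> {RV P >-> R})
    (S_subord : driftless_subordinator sigma S)
    (G : R -> R -> R)
    (G_density : forall t, 0 < t ->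
       is_density_on_nonneg P (inverse_process S t) (G t))
    (alpha : R) (alpha_gt0 : 0 < alpha) (alpha_lt1 : alpha < 1)
    (K_equiv : asymp_equiv (0 : R)^'+ (levy_tail_laplace sigma)
                 (fun lambda => lambda `^ (alpha - 1)))
    (beta : R) (beta_gt0 : 0 < beta) (beta_lt1 : beta < 1)
    (x : R -> R)
    (x_front : forall t, 0 < t ->
       cesaro_mean (subordination (traveling_wave v psi) G (x t)) t = beta) :
  (exists Cm Cp : R, [/\ 0 < Cm, 0 < Cp &
     \forall t \near +oo, Cm * t `^ alpha <= x t <= Cp * t `^ alpha]) /\
  (exists2 C : R, 0 < C &
     asymp_equiv +oo x (fun t => C * t `^ alpha)).
Proof.
pose J := front_profile S alpha.
have [c c0 [Jlo Jhi]] : exists2 c, 0 < c &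
    (forall a, 0 < a < c -> beta < J a) /\ (forall a, c < a -> J a < beta).
  apply: (@level_crossing _ alpha) => //; last by rewrite beta_gt0.
  - exact: (front_profile_le_expR sigma_levy S_subord alpha_gt0 K_equiv).
  - exact: (front_profile_ge_expR sigma_levy S_subord alpha_gt0 K_equiv).
  - exact: (front_profile_nonincreasing sigma_levy S_subord alpha_gt0 K_equiv).
  - exact: (front_profile_convex sigma_levy S_subord alpha_gt0 K_equiv).
have cvgJ := cvg_scaled_front_profile sigma_levy S_subord alpha_gt0 K_equiv.
(* The separation grows like [t ^ alpha], so it eventually absorbs any fixed offset [y], in
   particular the cut-offs [xm] and [xp]. *)
have gap a b y : 0 <= a -> a < b ->
    \forall t \near +oo, v * (a * t) `^ alpha + y < v * (b * t) `^ alpha.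
  move=> a0 ab; have b0 := le_lt_trans a0 ab.
  have k0 : 0 < v * (b `^ alpha - a `^ alpha).
    by rewrite mulr_gt0// subr_gt0 gt0_ltr_powR// ?nnegrE ?(ltW b0).
  have ty : \forall t \near +oo, y < v * (b `^ alpha - a `^ alpha) * t `^ alpha.
    exact: (cvgryPgt _).1 (gt0_cvgMry k0 (powR_cvg_pinfty alpha_gt0)) y.
  near=> t; have t0 : 0 < t by near: t; exact: nbhs_pinfty_gt.
  have yt : y < v * (b `^ alpha - a `^ alpha) * t `^ alpha by near: t.
  rewrite -ltrBrDl (lt_le_trans yt)// !powRM ?(ltW t0) ?(ltW b0)//; lra.
have lo a : 0 < a < c -> \forall t \near +oo, v * (a * t) `^ alpha <= x t.
  (* An intermediate constant: [a < a1] leaves room for [gap], and [a1 < c] keeps [J a1] above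
     [beta]. *)
  move=> /andP[a0 ac]; pose a1 := (a + c) / 2.
  have aa1 : a < a1 by rewrite /a1; lra.
  have a10 := lt_trans a0 aa1.
  have bJ : beta < J a1 by apply: Jlo; rewrite a10 /a1; lra.
  have Ja0 := lt_trans beta_gt0 bJ.
  (* Any [q] strictly between [beta / J a1] and 1 will do: [q * J a1] still exceeds [beta], and the
     wave exceeds [q] behind [xm (1 - q)]. *)
  pose q := (beta / J a1 + 1) / 2.
  have bJ0 : 0 < beta / J a1 by rewrite divr_gt0.
  have bJ1 : beta / J a1 < 1 by rewrite ltr_pdivrMr// mul1r.
  have q0 : 0 < q by rewrite /q; lra.
  have q1 : 0 < 1 - q by rewrite /q; lra.
  have bq : beta < q * J a1 by rewrite -ltr_pdivrMr// /q; lra.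
  apply: filterS3 (nbhs_pinfty_gt (num_real 0)) (gap _ _ (- xm (1 - q)) (ltW a0) aa1)
    (cvgr_gt _ (cvgMr (a := q) (cvgJ a1 a10)) _ bq) => t t0 vxm bI.
  (* Otherwise, by [gap], every [r] from [(a1 * t) ^ alpha] on has [x t - v * r] below the cut-off,
     and the Cesaro mean at [x t] would exceed [beta]. *)
  rewrite leNgt; apply/negP => xv.
  suff : q * \int[P]_w ramp (subord_pos S ((a1 * t) `^ alpha) w / t) <= beta.
    by rewrite leNgt bI.
  rewrite -(x_front t t0).
  apply: (cesaro_mean_ge S_subord G_density) => // [||r r_ge].
  - exact: powR_ge0.
  - exact: ltW.
  - rewrite -[q](subKr 1) ltW// xmP//.
    have : v * (a1 * t) `^ alpha <= v * r by rewrite ler_pM2l.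
    lra.
have hi a : c < a -> \forall t \near +oo, x t <= v * (a * t) `^ alpha.
  move=> ca; pose a1 := (a + c) / 2.
  have a1a : a1 < a by rewrite /a1; lra.
  have ca1 : c < a1 by rewrite /a1; lra.
  have a10 := lt_trans c0 ca1.
  have Jb := Jhi a1 ca1.
  (* Half of the deficit pays for the wave ahead of the front; the other half keeps the limit [J a1]
     strictly below [beta - eps]. *)
  pose eps := (beta - J a1) / 2.
  have e0 : 0 < eps by rewrite /eps; lra.
  have Jbe : J a1 < beta - eps by rewrite /eps; lra.
  apply: filterS3 (nbhs_pinfty_gt (num_real 0)) (gap _ _ (xp eps) (ltW a10) a1a)
    (cvgr_lt _ (cvgJ a1 a10) _ Jbe) => t t0 vxp bI.
  rewrite leNgt; apply/negP => xv.
  suff : beta <= eps + \int[P]_w ramp (subord_pos S ((a1 * t) `^ alpha) w / t).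
    by rewrite leNgt -ltrBrDl bI.
  rewrite -[leLHS](x_front t t0).
  apply: (cesaro_mean_le S_subord G_density) => // [||r r_le].
  - exact: powR_ge0.
  - exact: ltW.
  - rewrite ltW// xpP//.
    have : v * r <= v * (a1 * t) `^ alpha by rewrite ler_pM2l.
    lra.
split; last first.
  by exists (v * c `^ alpha); [rewrite mulr_gt0 ?powR_gt0|exact: asymp_equiv_powR].
(* Any constants on either side of [c] would serve; these are the bounds at [c / 2] and [2 * c]. *)
exists (v * (c / 2) `^ alpha), (v * (2 * c) `^ alpha).
have h0 : 0 < c / 2 by rewrite divr_gt0.
split; [by rewrite mulr_gt0 ?powR_gt0|by rewrite mulr_gt0 ?powR_gt0 ?mulr_gt0|].
have l2 : 0 < c / 2 < c by apply/andP; split => //; lra.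
have h2 : c < 2 * c by lra.
apply: filterS3 (nbhs_pinfty_gt (num_real 0)) (lo _ l2) (hi _ h2) => t t0.
by rewrite !powRM ?(ltW t0) ?(ltW h0) ?mulr_ge0 ?(ltW c0)// !mulrA => -> ->.
Unshelve. all: by end_near. Qed.
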